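(* Let $\mathbf P=(P,\le,1)$ be a poset with greatest element $1$, let $\mathbf Q=(Q,\le,0)$ be a poset with least element $0$, let $a$ be an atom of $\mathbf Q$ and let $b\in P$. Suppose there exist some coatom $c$ of $\mathbf P$ with $c\not\ge b$ and $(\downarrow c)\cup[b,1]=P$, and some $d\in Q$ with $d\not\ge a$ and $[0,d]\cup(\uparrow a)=Q$. Then the mapping $f\colon P\to Q$ defined by \[ f(x):=\begin{cases} a & \text{if }x\ge b,\\ 0 & \text{otherwise}\end{cases} \] is a weakly regular residuated mapping from $\mathbf P$ to $\mathbf Q$.
   Context: $\downarrow c=\{x\in P\mid x\le c\}$, $\uparrow a=\{y\in Q\mid a\le y\}$, and $[u,v]=\{x\mid u\le x\le v\}$. An atom is an element covering the least element $0$; a coatom is an element covered by the greatest element $1$. A mapping $f\colon P\to Q$ between posets is residuated if there is a mapping $f^*\colon Q\to P$ such that for all $x\in P$, $y\in Q$: $f(x)\le y$ if and only if $x\le f^*(y)$; such $f^*$ is uniquely determined by $f$. For $\mathbf P$ with greatest element $1$ and $\mathbf Q$ with least element $0$, a residuated mapping $f$ is called range-closed if $f(P)=[0,f(1)]$, dually range-closed if $f^*(Q)=[f^*(0),1]$, and weakly regular if it is both range-closed and dually range-closed. *)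

(* Defs.v *)
From mathcomp Require Import all_boot all_order all_algebra.
From mathcomp Require Import all_classical.

Set Implicit Arguments.
Unset Strict Implicit.
Unset Printing Implicit Defensive.

Import Order.TTheory.
Local Open Scope order_scope.
Local Open Scope classical_set_scope.

Definition covers d (T : porderType d) (x y : T) : Prop :=
  x < y /\ ~ exists z : T, x < z < y.

Definition atom d (T : bPOrderType d) (a : T) : Prop := covers \bot a.

Definition coatom d (T : tPOrderType d) (c : T) : Prop := covers c \top.

Definition residual_of dP dQ (P : porderType dP) (Q : porderType dQ)
    (f : P -> Q) (g : Q -> P) : Prop :=
  forall (x : P) (y : Q), f x <= y <-> x <= g y.

Definition residuated dP dQ (P : porderType dP) (Q : porderType dQ)
    (f : P -> Q) : Prop :=
  exists g : Q -> P, residual_of f g.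

Definition range_closed dP dQ (P : tPOrderType dP) (Q : bPOrderType dQ)
    (f : P -> Q) : Prop :=
  residuated f /\ range f = `[\bot, f \top].

(* A mapping has at most one residual, so [g] below is "the" residual of [f]. *)
Definition dually_range_closed dP dQ (P : tPOrderType dP) (Q : bPOrderType dQ)
    (f : P -> Q) : Prop :=
  exists g : Q -> P, residual_of f g /\ range g = `[g \bot, \top].

Definition weakly_regular dP dQ (P : tPOrderType dP) (Q : bPOrderType dQ)
    (f : P -> Q) : Prop :=
  range_closed f /\ dually_range_closed f.

(* Main.v *)
Require Import Defs.
From mathcomp Require Import all_boot all_order all_algebra.
From mathcomp Require Import all_classical.

Import Order.TTheory.
Local Open Scope order_scope.
Local Open Scope classical_set_scope.

(** The residual of [f] sends [y] to [1] when [a <= y] and to [c] otherwise.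
    Both [f] and its residual are two-valued, and the intervals [[0, a]] and
    [[c, 1]] have exactly two elements since [a] is an atom and [c] a coatom. *)

Lemma covers_itvcc d (T : porderType d) (x y : T) :
  covers x y -> `[x, y] = [set x; y].
Proof.
move=> [ltxy nbetween]; apply/seteqP; split => z /=; rewrite in_itv /=.
  move=> /andP[lexz lezy].
  have [->|neqzx] := eqVneq z x; first by left.
  have [->|neqzy] := eqVneq z y; first by right.
  by case: nbetween; exists z; rewrite !lt_neqAle lexz lezy eq_sym neqzx neqzy.
by case=> ->; rewrite lexx (ltW ltxy).
Qed.

Lemma range_two_values {S T : Type} (p : S -> bool) (u v : T) (s t : S) :
  p s -> ~~ p t -> range (fun x => if p x then u else v) = [set v; u].
Proof.
move=> ps npt; apply/seteqP; split => z /=.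
  by case=> x _ <-; case: (p x); [right | left].
by case=> ->; [exists t; rewrite // (negbTE npt) | exists s; rewrite // ps].
Qed.

(** Only two of the four cases have content. If [b <= x] but [a <= y] fails, [x <= c] would force
    [b <= c]. If neither holds, the covering of [P] puts [x] below [c]. *)
Lemma residual_of_two_valued dP dQ (P : tPOrderType dP) (Q : bPOrderType dQ)
    (a : Q) (b c : P) :
  ~ (b <= c) -> `]-oo, c] `|` `[b, \top] = [set: P] ->
  residual_of (fun x : P => if b <= x then a else \bot)
              (fun y : Q => if a <= y then \top else c).
Proof.
move=> nbc cover x y.
case: ifPn => [bx|nbx]; case: ifPn => [ay|nay]; rewrite ?lex1 ?le0x //.
  by split=> // xc; case: nbc; exact: le_trans bx xc.
split=> // _; have: [set: P] x by [].
by rewrite -cover; case; rewrite /= in_itv //= (negbTE nbx).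
Qed.

Theorem theorem5p3 (dP dQ : Order.disp_t)
    (P : tPOrderType dP) (Q : bPOrderType dQ) (a : Q) (b : P)
    (ha : atom a)
    (hc : exists c : P, coatom c /\ ~ (b <= c) /\
            `]-oo, c] `|` `[b, \top] = [set: P])
    (hd : exists d : Q, ~ (a <= d) /\
            `[\bot, d] `|` `[a, +oo[ = [set: Q]) :
  let f : P -> Q := fun x => if b <= x then a else \bot in
  residuated f /\ weakly_regular f.
Proof.
move=> f; have [c [cc [nbc cover]]] := hc.
have fg := @residual_of_two_valued _ _ P Q a b c nbc cover.
have na0 : ~~ (a <= \bot) by rewrite lt_geF //; case: ha.
have fres : residuated f by eexists; exact: fg.
split=> //; split.
  (* Since [b <= \top], the upper end [f \top] is [a], and the interval collapses to [\bot] and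
     [a]. *)
  split=> //; rewrite {2}/f lex1 (covers_itvcc _ _ _ _ ha).
  (* Both values occur: [a] at [\top], and [\bot] at [c], which is not above [b]. *)
  by apply: (range_two_values _ _ _ \top c); [exact: lex1 | exact/negP].
eexists; split; first exact: fg.
(* The residual sends [\bot] to [c], so the interval to fill is [c] and [\top], the values at [\bot]
   and [a]. *)
rewrite /= (negbTE na0) (covers_itvcc _ _ _ _ cc).
exact: (range_two_values _ _ _ a \bot).
Qed.
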